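(* Let $X$ be an $m\times m$ real symmetric matrix with strictly positive diagonal entries, non-positive off-diagonal entries and non-negative row sums, let $W=\mathrm{diag}(\mu_1,\dots,\mu_m)$ with all $\mu_i>0$, let $M=W^{-1/2}XW^{-1/2}$, and let $\Delta=\max_{1\le i\le m}X_{ii}/\mu_i$. Assume that the interior graph associated with $X$ is connected. 1. (Boundaryless) If all row sums of $X$ are equal to $0$, then $$\frac{h_{\mathrm{vol}}^2}{2\Delta}\le\lambda_1(M)\le 2h_{\mathrm{vol}},$$ where $\lambda_1(M)$ denotes the smallest nonzero eigenvalue of $M$. 2. (Dirichlet) If at least one row sum of $X$ is positive, then $M$ is positive definite and $$\frac{(h_{\mathrm{vol}}^{\mathrm{Bdy}})^2}{2\Delta}\le\lambda_1(M)\le h_{\mathrm{vol}}^{\mathrm{Bdy}},$$ where $\lambda_1(M)$ denotes the smallest eigenvalue of $M$.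
   Context: For $i\ne j$ put $w_{ij}=-X_{ij}\ge0$, and let $b_i=\sum_{j=1}^mX_{ij}\ge0$. The interior graph associated with $X$ has vertices $1,\dots,m$ and an edge between $i\ne j$ whenever $X_{ij}<0$. For $S\subseteq\{1,\dots,m\}$ let $$\mathrm{Vol}(S)=\sum_{i\in S}\mu_i,\qquad\mathrm{Cut}(S)=\sum_{i\in S,\,j\notin S}w_{ij},\qquad\mathrm{Bdy}(S)=\sum_{i\in S}b_i,$$ and $V_{\mathrm{tot}}=\mathrm{Vol}(\{1,\dots,m\})$. If all row sums of $X$ vanish, set $$h_{\mathrm{vol}}=\min_{\substack{\varnothing\ne S\subseteq\{1,\dots,m\}\\ \mathrm{Vol}(S)\le V_{\mathrm{tot}}/2}}\frac{\mathrm{Cut}(S)}{\mathrm{Vol}(S)};$$ if at least one row sum is positive, set $$h_{\mathrm{vol}}^{\mathrm{Bdy}}=\min_{\varnothing\ne S\subseteq\{1,\dots,m\}}\frac{\mathrm{Cut}(S)+\mathrm{Bdy}(S)}{\mathrm{Vol}(S)}.$$ *)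

(* Defs.v *)
From mathcomp Require Import all_boot all_order all_algebra.
From mathcomp Require Import reals.

Set Implicit Arguments.
Unset Strict Implicit.
Unset Printing Implicit Defensive.

Import Order.TTheory GRing.Theory Num.Theory.
Local Open Scope ring_scope.

Section Extrema.
Context {R : realType}.

Definition is_least (P : R -> Prop) (x : R) : Prop :=
  P x /\ forall y, P y -> x <= y.

Definition is_greatest (P : R -> Prop) (x : R) : Prop :=
  P x /\ forall y, P y -> y <= x.

(* The extremum of F over the indices satisfying P; the value 0 is used only
   when no index satisfies P (see min_overP and max_overP). *)
Definition min_over (I : finType) (P : pred I) (F : I -> R) : R :=
  if [pick i | P i] is Some i0 then F [arg min_(i < i0 | P i) F i]%O else 0.

Definition max_over (I : finType) (P : pred I) (F : I -> R) : R :=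
  if [pick i | P i] is Some i0 then F [arg max_(i > i0 | P i) F i]%O else 0.

Lemma min_overP (I : finType) (P : pred I) (F : I -> R) :
  (exists i, P i) ->
  is_least (fun x => exists2 i, P i & x = F i) (min_over P F).
Proof.
move=> [j Pj]; rewrite /min_over; case: pickP => [i0 Pi0 | P0]; last first.
  by move: Pj; rewrite P0.
case: arg_minP => // i Pi le_i; split; first by exists i.
by move=> _ [k Pk ->]; apply: le_i.
Qed.

Lemma max_overP (I : finType) (P : pred I) (F : I -> R) :
  (exists i, P i) ->
  is_greatest (fun x => exists2 i, P i & x = F i) (max_over P F).
Proof.
move=> [j Pj]; rewrite /max_over; case: pickP => [i0 Pi0 | P0]; last first.
  by move: Pj; rewrite P0.
case: arg_maxP => // i Pi le_i; split; first by exists i.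
by move=> _ [k Pk ->]; apply: le_i.
Qed.

End Extrema.

Section Definitions.
Context {R : realType} {m : nat}.
Implicit Types (X M : 'M[R]_m) (mu : 'rV[R]_m) (S : {set 'I_m}).

(* Only meaningful for i != j. *)
Definition weight X (i j : 'I_m) : R := - X i j.

Definition row_sum X (i : 'I_m) : R := \sum_j X i j.

Definition interior_edge X : rel 'I_m := [rel i j | (i != j) && (X i j < 0)].

Definition interior_connected X : Prop :=
  forall i j, connect (interior_edge X) i j.

Definition Vol mu S : R := \sum_(i in S) mu 0 i.

Definition Vtot mu : R := Vol mu [set: 'I_m].

Definition Cut X S : R := \sum_(i in S) \sum_(j | j \notin S) weight X i j.

Definition Bdy X S : R := \sum_(i in S) row_sum X i.

Definition h_vol X mu : R :=
  min_over (fun S => (S != set0) && (Vol mu S <= Vtot mu / 2))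
           (fun S => Cut X S / Vol mu S).

Definition h_vol_Bdy X mu : R :=
  min_over (fun S => S != set0)
           (fun S => (Cut X S + Bdy X S) / Vol mu S).

(* W^(-1/2) for W = diag_mx mu with positive diagonal entries. *)
Definition inv_sqrt_diag mu : 'M[R]_m :=
  diag_mx (map_mx (fun x => (Num.sqrt x)^-1) mu).

Definition normalized X mu : 'M[R]_m :=
  inv_sqrt_diag mu *m X *m inv_sqrt_diag mu.

Definition Delta X mu : R := max_over xpredT (fun i => X i i / mu 0 i).

Definition is_smallest_eigenvalue M (l : R) : Prop :=
  is_least (fun a => eigenvalue M a) l.

Definition is_smallest_nonzero_eigenvalue M (l : R) : Prop :=
  is_least (fun a => eigenvalue M a /\ a != 0) l.

Definition positive_definite M : Prop :=
  M^T = M /\ forall v : 'cV[R]_m, v != 0 -> 0 < (v^T *m M *m v) 0 0.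

End Definitions.

(* Main.v *)
(* Put M = W^(-1/2) X W^(-1/2) and substitute v = W^(1/2) f: an eigenvector of M
   for l becomes a solution of X f = l W f, and the Rayleigh quotient becomes
   energy f / mass f = f^T X f / sum_i mu_i f_i^2.

   Upper bounds: the smallest (nonzero) eigenvalue minimizes this quotient (over
   the f with sum_i mu_i f_i = 0 in the boundaryless case), and one tests it on
   1_S, respectively on 1_S - Vol(S)/V_tot.

   Lower bounds: changing the sign of the eigenvector f if necessary, its positive
   part p is nonzero, energy p <= l * mass p, and h Vol(S) <= Cut(S) + Bdy(S) for
   all nonempty S inside its support.  The coarea inequality bounds h * mass p by
   the total variation of p^2 (plus its boundary term), which AM-GM with
   parameter c = h / l bounds in turn by the energy of p. *)

Require Import Defs.
From mathcomp Require Import classical_sets topology normedtype derive.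
From mathcomp Require Import all_boot all_order all_algebra.
From mathcomp Require Import reals ring lra.

Set Implicit Arguments.
Unset Strict Implicit.
Unset Printing Implicit Defensive.

Import Order.TTheory GRing.Theory Num.Theory numFieldNormedType.Exports.
Local Open Scope ring_scope.

(** * Smallest eigenvalue of a symmetric matrix *)

Section SymmetricMatrix.
Variables (R : realType) (n : nat).
Implicit Types (A : 'M[R]_n) (s u v w : 'rV[R]_n).

(** Row vectors match [eigenvalue], which is about left eigenvectors [v *m A = a *: v]. *)
Definition dot u v : R := (u *m v^T) 0 0.

Lemma dotE u v : dot u v = \sum_j u 0 j * v 0 j.
Proof. by rewrite /dot mxE; apply: eq_bigr => j _; rewrite mxE. Qed.

Lemma dotC u v : dot u v = dot v u.
Proof. by rewrite !dotE; apply: eq_bigr => j _; rewrite mulrC. Qed.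

Lemma dotDl u v w : dot (u + v) w = dot u w + dot v w.
Proof. by rewrite /dot mulmxDl mxE. Qed.

Lemma dotZl a u v : dot (a *: u) v = a * dot u v.
Proof. by rewrite /dot -scalemxAl mxE. Qed.

Lemma dotDr u v w : dot u (v + w) = dot u v + dot u w.
Proof. by rewrite dotC dotDl !(dotC _ u). Qed.

Lemma dotZr a u v : dot u (a *: v) = a * dot u v.
Proof. by rewrite dotC dotZl dotC. Qed.

Lemma dot_sym A u v : A^T = A -> dot (u *m A) v = dot u (v *m A).
Proof. by move=> As; rewrite /dot trmx_mul As mulmxA. Qed.

Lemma dot_ge0 u : 0 <= dot u u.
Proof. by rewrite dotE sumr_ge0 // => j _; rewrite -expr2 sqr_ge0. Qed.

Lemma dot_eq0 u : (dot u u == 0) = (u == 0).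
Proof.
apply/eqP/eqP => [u0|->]; last by rewrite /dot mul0mx mxE.
apply/rowP => j; rewrite mxE; apply/eqP; rewrite -sqrf_eq0 expr2; apply/eqP.
move: u0; rewrite dotE => /psumr_eq0P; apply=> // i _.
by rewrite -expr2 sqr_ge0.
Qed.

Lemma continuous_coord_dot (f g : 'rV[R]_n -> 'rV[R]_n) :
  (forall j, continuous (fun u => f u 0 j)) ->
  (forall j, continuous (fun u => g u 0 j)) ->
  continuous (fun u => dot (f u) (g u)).
Proof.
move=> cf cg.
rewrite (_ : (fun u => _) = fun u => \sum_j f u 0 j * g u 0 j); last first.
  by apply/boolp.funext => u; rewrite -dotE.
apply: continuous_big => [|j _]; first exact: add_continuous.
by move=> u; apply: continuousM; [apply: cf|apply: cg].
Qed.

Lemma coord_mulmx_continuous A j : continuous (fun u => (u *m A) 0 j).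
Proof.
rewrite (_ : (fun u => _) = fun u : 'rV_n => \sum_i u 0 i * A i j); last first.
  by apply/boolp.funext => u; rewrite mxE.
apply: continuous_big => [|i _]; first exact: add_continuous.
by move=> u; apply: continuousM; [exact: coord_continuous|exact: cst_continuous].
Qed.

(* Minimize the Rayleigh quotient on the unit sphere of the orthogonal
   complement of s, which A preserves because s is in its kernel. *)
Lemma symmetric_min_eigenvector A s : A^T = A -> s *m A = 0 ->
  (exists2 v, v != 0 & dot v s = 0) ->
  exists l, (exists2 v, v != 0 /\ dot v s = 0 & v *m A = l *: v) /\
    forall u, dot u s = 0 -> l * dot u u <= dot (u *m A) u.
Proof.
move=> As sA [v0 v0_neq0 v0s].
pose K : set 'rV[R]_n :=
  ([set u | dot u u = 1] `&` [set u | dot u s = 0])%classic.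
have normK u : u != 0 -> exists2 a, a != 0 & dot (a *: u) (a *: u) = 1.
  move=> u0; have d0 : 0 < dot u u by rewrite lt0r dot_eq0 u0 dot_ge0.
  exists (Num.sqrt (dot u u))^-1; first by rewrite invr_eq0 gt_eqF ?sqrtr_gt0.
  by rewrite dotZl dotZr mulrA -invfM -expr2 sqr_sqrtr ?dot_ge0// mulVf ?gt_eqF.
have K0 : (K !=set0)%classic.
  have [a _ a1] := normK _ v0_neq0; exists (a *: v0); split => //=.
  by rewrite dotZl v0s mulr0.
have Kc : compact K.
  apply: bounded_closed_compact.
    exists 1; split=> // M M1 u [/= u1 _]; rewrite /Num.norm /= mx_normrE.
    apply/bigmax_leP; split=> [|[i j] _ /=].
      by rewrite ltW// (lt_trans _ M1).
    rewrite ord1 (le_trans _ (ltW M1))// -(@expr_le1 _ 2)//.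
    rewrite -normrX ger0_norm ?sqr_ge0//.
    rewrite -u1 dotE (bigD1 j)//= -expr2 lerDl.
    by rewrite sumr_ge0 // => k _; rewrite -expr2 sqr_ge0.
  apply: closedI.
    apply: (@preimage_closed _ _ (fun u => dot u u) [set x | x = 1]%classic).
      by move=> u _; apply: continuous_coord_dot => j; exact: coord_continuous.
    exact: closed_eq.
  apply: (@preimage_closed _ _ (fun u => dot u s) [set x | x = 0]%classic).
    move=> u _; apply: continuous_coord_dot => j; first exact: coord_continuous.
    exact: cst_continuous.
  exact: closed_eq.
have qc : {within K, continuous (fun u => dot (u *m A) u)}%classic.
  apply: continuous_subspaceT; apply: continuous_coord_dot => j.
    exact: coord_mulmx_continuous.
  exact: coord_continuous.
have [v] := EVT_min_rV K0 Kc qc.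
rewrite classical_sets.inE => -[/= v1 vs] vmin.
pose l := dot (v *m A) v; exists l.
have lmin u : dot u s = 0 -> l * dot u u <= dot (u *m A) u.
  move=> us; have [->|u0] := eqVneq u 0.
    by rewrite mul0mx /dot mul0mx mxE mulr0.
  have [a a0 a1] := normK _ u0.
  have /vmin : (a *: u) \in K.
    by rewrite classical_sets.inE; split=> //=; rewrite dotZl us mulr0.
  rewrite -scalemxAl !dotZl !dotZr -/l => le_l.
  move: a1; rewrite dotZl dotZr => a1.
  have a2 : 0 < a ^+ 2 by rewrite exprn_even_gt0.
  rewrite -(ler_pM2l a2) mulrCA expr2 -[a * a * dot u u]mulrA a1 mulr1.
  by rewrite -mulrA.
split=> //.
exists v; first by split; [rewrite -dot_eq0 v1 oner_eq0|].
(* The residual of the eigenvalue equation is orthogonal to [s], so the minimizer may be perturbed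
   along it. *)
pose w := v *m A - l *: v.
suff /eqP : w = 0 by rewrite subr_eq0 => /eqP.
have ws : dot w s = 0.
  rewrite /w dotDl -scaleNr dotZl vs mulr0 addr0 dot_sym// sA.
  by rewrite /dot trmx0 mulmx0 mxE.
have wE : v *m A = w + l *: v by rewrite subrK.
clearbody w; pose b := dot (w *m A) w - l * dot w w.
have b0 : 0 <= b by rewrite subr_ge0 lmin.
(* Minimality at [v + t *: w]: the terms constant in [t] cancel, and the linear coefficient is twice
   the squared norm of the residual. *)
have lb t : 0 <= 2 * t * dot w w + t ^+ 2 * b.
  have := lmin (v + t *: w); rewrite dotDl dotZl vs ws mulr0 addr0 => /(_ erefl).
  rewrite -subr_ge0 mulmxDl !(dotDl, dotDr) -!scalemxAl !(dotZl, dotZr) -/l v1.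
  rewrite (dot_sym w v As) (dotC w (v *m A)) (dotC w v).
  have -> : dot (v *m A) w = dot w w + l * dot v w.
    by rewrite wE dotDl dotZl.
  by congr (0 <= _); rewrite /b; ring.
apply/eqP; rewrite -dot_eq0 -sqrf_eq0 eq_le sqr_ge0 andbT.
have b1 : 0 < b + 1 by rewrite ltr_wpDl.
(* This negative [t] violates the bound unless [w = 0]; using [b + 1] instead of [b] avoids a
   division by zero. *)
have := lb (- (dot w w / (b + 1))).
rewrite -(pmulr_rge0 _ (exprn_gt0 2 b1)).
have -> : (b + 1) ^+ 2 * (2 * - (dot w w / (b + 1)) * dot w w +
    (- (dot w w / (b + 1))) ^+ 2 * b) = - (b + 2) * dot w w ^+ 2.
  by field; rewrite gt_eqF.
by rewrite mulNr oppr_ge0 pmulr_rle0// ltr_wpDl.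
Qed.

End SymmetricMatrix.

(** * Coarea inequality and Dirichlet energy *)

Section CheegerInequality.
Variables (R : realType) (m : nat) (X : 'M[R]_m) (mu : 'rV[R]_m).
Implicit Types (f g : 'I_m -> R) (S T : {set 'I_m}) (h c l : R).

Definition energy f : R := \sum_i \sum_j f i * X i j * f j.
Definition mass f : R := \sum_i mu 0 i * f i ^+ 2.
(** Total variation counting only the drops from [i] to [j], so that the indicator of [S] yields
    [Cut X S + Bdy X S]; a row sum acts as an edge to an outer vertex of value 0. *)
Definition flow g : R :=
  \sum_i \sum_j weight X i j * Num.max (g i - g j) 0
  + \sum_i row_sum X i * g i.

(** As [g] is nonnegative and vanishes off [S], raising it by [t] on [S] keeps the drops inside [S],
    adds [t] to each drop leaving [S], and creates none entering it. *)
Lemma flow_add_indicator g S t : 0 <= t ->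
  (forall i, 0 <= g i) -> (forall i, i \notin S -> g i = 0) ->
  flow (fun i => g i + t * (i \in S)%:R) = flow g + t * (Cut X S + Bdy X S).
Proof.
move=> t0 g0 gS.
have -> : Cut X S = \sum_i \sum_j weight X i j * ((i \in S) && (j \notin S))%:R.
  rewrite /Cut [LHS]big_mkcond; apply: eq_bigr => i _; case: (i \in S) => /=.
    by rewrite big_mkcond; apply: eq_bigr => j _; case: (j \in S);
      rewrite ?mulr0 ?mulr1.
  by rewrite big1 // => j _; rewrite mulr0.
have -> : Bdy X S = \sum_i row_sum X i * (i \in S)%:R.
  by rewrite /Bdy big_mkcond; apply: eq_bigr => i _; case: (i \in S);
      rewrite ?mulr0 ?mulr1.
rewrite /flow mulrDr addrACA !mulr_sumr.
congr (_ + _); rewrite -big_split; apply: eq_bigr => i _.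
  rewrite mulr_sumr -big_split; apply: eq_bigr => j _ /=.
  rewrite mulrCA -mulrDr; congr (_ * _).
  have [iS|/gS gi] := boolP (i \in S); have [jS|/gS gj] := boolP (j \in S);
    rewrite /= ?mulr0 ?mulr1 ?addr0 //.
  - by congr (Num.max _ 0); ring.
  - by rewrite gj !subr0 !max_l// addr_ge0.
  - rewrite gi !max_r ?subr_le0// ?addr_ge0//.
by rewrite /=; ring.
Qed.

(* Peel off the indicator functions of the superlevel sets of g. *)
Lemma coarea h T g :
  (forall S, S != set0 -> S \subset T -> h * Vol mu S <= Cut X S + Bdy X S) ->
  (forall i, 0 <= g i) -> (forall i, i \notin T -> g i = 0) ->
  h * (\sum_i mu 0 i * g i) <= flow g.
Proof.
move=> hT; have [k] := ubnP #|[set i | g i != 0]|.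
elim: k g => // k IH g cardg g0 gT.
pose S := [set i | g i != 0].
have gS i : i \notin S -> g i = 0 by rewrite inE negbK => /eqP.
have [S0|[i1 i1S]] := set_0Vmem S.
  have {}gS i : g i = 0 by apply: gS; rewrite S0 inE.
  rewrite /flow !big1 ?mulr0 ?addr0 // => i _; rewrite ?gS ?mulr0 //.
  by rewrite big1// => j _; rewrite !gS subrr maxxx mulr0.
(* The value [g i0] is the least positive one. Subtracting it on the support [S] keeps [g]
   nonnegative and removes [i0] from the support, so the induction on support size applies. *)
have [i0 i0S le_i0] := @arg_minP _ _ _ i1 [in S] g i1S.
have {}i0S : i0 \in S by [].
pose t := g i0; pose g' i := g i - t * (i \in S)%:R.
have gE : g =1 fun i => g' i + t * (i \in S)%:R by move=> i; rewrite /g' subrK.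
have g'0 i : 0 <= g' i.
  rewrite /g'; have [iS|iS] := boolP (i \in S); rewrite ?mulr1 ?mulr0 ?subr0//.
  by rewrite subr_ge0 le_i0.
have g'S i : i \notin S -> g' i = 0.
  by move=> iS; rewrite /g' (negbTE iS) mulr0 subr0 gS.
have ST : S \subset T.
  by apply/subsetP => i; rewrite inE; apply: contraNT => /gT ->.
have -> : flow g = flow (fun i => g' i + t * (i \in S)%:R).
  rewrite /flow; congr (_ + _); apply: eq_bigr => i _; last by rewrite gE.
  by apply: eq_bigr => j _; rewrite !gE.
rewrite flow_add_indicator ?g0 //.
have -> : \sum_i mu 0 i * g i = \sum_i mu 0 i * g' i + t * Vol mu S.
  rewrite /Vol mulr_sumr [X in _ = _ + X]big_mkcond -big_split.
  apply: eq_bigr => i _; rewrite gE mulrDr /=; case: (i \in S); rewrite ?mulr0//.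
  by rewrite mulr1 [t * _]mulrC.
rewrite mulrDr lerD//.
  apply: IH => [||i /(contra (subsetP ST i))/g'S] //.
  rewrite -ltnS (leq_trans _ cardg)// ltnS proper_card//; apply/properP; split.
    apply/subsetP => i; rewrite !inE; apply: contraNN => gi.
    by rewrite g'S// inE negbK.
  by exists i0 => //; rewrite inE negbK /g' i0S mulr1 subrr.
rewrite mulrCA ler_wpM2l ?g0// hT//; apply/set0Pn; by exists i0.
Qed.

(** * Energy and total variation as sums over edges of a symmetric matrix *)

Hypothesis X_sym : X^T = X.
Let symX i j : X i j = X j i. Proof. by rewrite -[in LHS]X_sym mxE. Qed.

(** Expand the square and swap [i] and [j]. Taking [s = -1] gives the energy in terms of
    differences; [s = 1] controls the sums [f i + f j] in [flow_square_le]. Diagonal terms are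
    included. *)
Lemma sum_weight_square f s : s ^+ 2 = 1 ->
  \sum_i \sum_j weight X i j * (f i + s * f j) ^+ 2 =
  - 2 * \sum_i row_sum X i * f i ^+ 2 - 2 * s * energy f.
Proof.
move=> s2.
have -> : \sum_i row_sum X i * f i ^+ 2 = \sum_i \sum_j X i j * f i ^+ 2.
  by apply: eq_bigr => i _; rewrite mulr_suml.
have E2 : \sum_i \sum_j X i j * f i ^+ 2 = \sum_i \sum_j X i j * f j ^+ 2.
  by rewrite exchange_big; apply: eq_bigr => i _; apply: eq_bigr => j _; rewrite symX.
rewrite mulNr mulrDl !mul1r {2}E2 opprD /energy mulr_sumr -!sumrN -!big_split.
apply: eq_bigr => i _; rewrite /= mulr_sumr -!sumrN -!big_split.
by apply: eq_bigr => j _; rewrite /weight /= sqrrD exprMn s2; ring.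
Qed.

Lemma energyE f :
  2 * energy f = \sum_i \sum_j weight X i j * (f i - f j) ^+ 2
    + 2 * \sum_i row_sum X i * f i ^+ 2.
Proof.
have := @sum_weight_square f (-1); rewrite sqrrN expr1n => /(_ erefl) E.
transitivity (\sum_i \sum_j weight X i j * (f i + -1 * f j) ^+ 2
    + 2 * \sum_i row_sum X i * f i ^+ 2); first by rewrite E; ring.
by congr (_ + _); apply: eq_bigr => i _; apply: eq_bigr => j _; rewrite mulN1r.
Qed.

(** Of the two orientations of a pair, one contributes the absolute difference and the other 0. *)
Lemma flowE g :
  2 * flow g = \sum_i \sum_j weight X i j * `|g i - g j|
    + 2 * \sum_i row_sum X i * g i.
Proof.
rewrite /flow mulrDr; congr (_ + _); rewrite mulrDl mul1r.
rewrite {2}exchange_big -big_split; apply: eq_bigr => i _ /=.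
rewrite -big_split; apply: eq_bigr => j _ /=.
rewrite {2}/weight symX -/(weight X i j) -mulrDr; congr (_ * _).
have [gij|/ltW gij] := leP (g i) (g j).
  by rewrite max_r ?subr_le0// max_l ?subr_ge0// add0r ler0_norm ?subr_le0// opprB.
by rewrite max_l ?subr_ge0// max_r ?subr_le0// addr0 ger0_norm ?subr_ge0.
Qed.

Hypothesis X_offdiag : forall i j, i != j -> X i j <= 0.
Hypothesis X_row_sum : forall i, 0 <= row_sum X i.

Let edge_energy_ge0 f i j : 0 <= weight X i j * (f i - f j) ^+ 2.
Proof.
have [->|ij] := eqVneq i j; first by rewrite subrr expr0n mulr0.
by rewrite mulr_ge0 ?sqr_ge0// oppr_ge0 X_offdiag.
Qed.

Let boundary_energy_ge0 f i : 0 <= row_sum X i * f i ^+ 2.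
Proof. by rewrite mulr_ge0 ?sqr_ge0. Qed.

Lemma energy_ge0 f : 0 <= energy f.
Proof.
rewrite -(pmulr_rge0 _ (ltr0n R 2)) energyE addr_ge0 ?mulr_ge0 ?sumr_ge0// => i _.
by rewrite sumr_ge0.
Qed.

(** Every term of [energyE] is nonnegative, hence zero: [f] agrees across each edge, and so along
    every path. *)
Lemma energy_eq0 f : interior_connected X -> energy f = 0 ->
  (forall i j, f i = f j) /\ forall i, row_sum X i * f i ^+ 2 = 0.
Proof.
move=> X_conn E0.
have S1 : 0 <= \sum_i \sum_j weight X i j * (f i - f j) ^+ 2.
  by apply: sumr_ge0 => i _; apply: sumr_ge0.
have S2 : 0 <= \sum_i row_sum X i * f i ^+ 2 by apply: sumr_ge0.
have := energyE f; rewrite E0 mulr0 => /esym/eqP.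
rewrite paddr_eq0 ?mulr_ge0// mulf_eq0 pnatr_eq0 /= => /andP[/eqP e1 /eqP e2].
split=> [i j|i]; last by have /psumr_eq0P/(_ i) := e2; apply.
have fE a b : interior_edge X a b -> f a = f b.
  move=> /andP[_ Xab]; apply/eqP; rewrite -subr_eq0 -sqrf_eq0.
  have /psumr_eq0P/(_ a) e3 := e1.
  have /psumr_eq0P/(_ b) : \sum_j weight X a j * (f a - f j) ^+ 2 = 0.
    by apply: e3 => // k _; apply: sumr_ge0.
  move=> /(_ (fun _ _ => edge_energy_ge0 _ _ _) isT)/eqP.
  by rewrite mulf_eq0 oppr_eq0 lt_eqF.
have /connectP[p] := X_conn i j.
elim: p i => [i _ -> //|k p IH i /= /andP[/fE -> kp] jE].
exact: IH kp jE.
Qed.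

(** Factor [f i ^+ 2 - f j ^+ 2] and apply AM-GM on each edge, with weight [c] on the difference and
    1 on the sum; [sum_weight_square] evaluates both resulting sums. *)
Lemma flow_square_le f c : 0 <= c ->
  2 * c * flow (fun i => f i ^+ 2) <=
  c ^+ 2 * energy f + 2 * \sum_i X i i * f i ^+ 2 - energy f.
Proof.
move=> c0; set D := \sum_i X i i * f i ^+ 2.
have := @sum_weight_square f 1; rewrite expr1n => /(_ erefl).
under eq_bigr => i _ do under eq_bigr => j _ do rewrite mul1r.
move=> Ep; have Em := energyE f; have Fl := flowE (fun i => f i ^+ 2).
set B := \sum_i row_sum X i * f i ^+ 2 in Ep Em Fl.
set P := \sum_i _ in Ep; set M := \sum_i _ in Em; set A := \sum_i _ in Fl.
suff le_A : 2 * c * A <= c ^+ 2 * M + P + 4 * D.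
  have B0 : 0 <= B by apply: sumr_ge0.
  (* The same AM-GM for the boundary edges, where difference and sum both equal [f i]. *)
  have B1 : 0 <= (c - 1) ^+ 2 * B by rewrite mulr_ge0 ?sqr_ge0.
  rewrite -(ler_pM2l (ltr0n R 2)).
  have M_E : M = 2 * energy f - 2 * B by rewrite Em addrK.
  have -> : 2 * (2 * c * flow (fun i => f i ^+ 2)) = 2 * c * A + 4 * c * B.
    by rewrite mulrCA Fl; ring.
  apply: (@le_trans _ _
    (c ^+ 2 * M + P + 4 * D + 4 * c * B + 2 * ((c - 1) ^+ 2 * B))).
    by rewrite -addrA lerD// lerDl mulr_ge0.
  by rewrite M_E Ep le_eqVlt; apply/orP; left; apply/eqP; ring.
(* Spread over the diagonal, [4 * D] cancels the diagonal terms of [P], whose weight is [- X i i];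
   the rest is compared term by term. *)
have -> : D = \sum_i \sum_j (i == j)%:R * (X i i * f i ^+ 2).
  apply: eq_bigr => i _; rewrite (bigD1 i)//= eqxx mul1r big1 ?addr0// => j.
  by rewrite eq_sym => /negbTE ->; rewrite mul0r.
rewrite !mulr_sumr -!big_split; apply: ler_sum => i _.
rewrite /= !mulr_sumr -!big_split; apply: ler_sum => j _ /=.
have [->|ij] := eqVneq i j.
  rewrite !subrr normr0 expr0n !mulr0 add0r mul1r /weight le_eqVlt.
  by apply/orP; left; apply/eqP; ring.
rewrite mul0r mulr0 addr0 mulrCA (mulrCA (c ^+ 2)) -mulrDr ler_wpM2l//.
  by rewrite oppr_ge0 X_offdiag.
rewrite subr_sqr normrM -subr_ge0.
rewrite -[in X in _ * X + _](real_normK (num_real (f i - f j)))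
  -[in X in _ + X - _](real_normK (num_real (f i + f j))).
have -> : c ^+ 2 * `|f i - f j| ^+ 2 + `|f i + f j| ^+ 2 -
    2 * c * (`|f i - f j| * `|f i + f j|) = (c * `|f i - f j| - `|f i + f j|) ^+ 2.
  by ring.
exact: sqr_ge0.
Qed.

(** Coarea for [f ^+ 2] and [flow_square_le] together give [h * c <= 2 * Delta X mu] for
    [c = h / l]; multiplying by [l] yields the claim. *)
Lemma cheeger_bound h l T f : 0 <= h -> 0 < l ->
  (forall S, S != set0 -> S \subset T -> h * Vol mu S <= Cut X S + Bdy X S) ->
  (forall i, 0 <= f i) -> (forall i, i \notin T -> f i = 0) ->
  0 < mass f -> energy f <= l * mass f ->
  (forall i, X i i <= Delta X mu * mu 0 i) -> h ^+ 2 / (2 * Delta X mu) <= l.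
Proof.
move=> h0 l0 hT f0 fT N0 El XD; set d := Delta X mu.
have D_le : \sum_i X i i * f i ^+ 2 <= d * mass f.
  by rewrite mulr_sumr ler_sum // => i _; rewrite mulrA ler_wpM2r ?sqr_ge0.
have hF : h * mass f <= flow (fun i => f i ^+ 2).
  by apply: coarea hT _ _ => [i|i /fT ->]; rewrite ?sqr_ge0 ?expr0n.
(* This [c] maximizes [2 * c * h - c ^+ 2 * l], the gain left once the energy is bounded by
   [l * mass f]. *)
have c0 : 0 <= h / l by rewrite divr_ge0// ltW.
have := flow_square_le f c0; set c := h / l in c0 * => Fc.
have lcE : l * c = h by rewrite mulrCA divff ?mulr1// gt_eqF.
clearbody c; have hd : h * c <= 2 * d.
  rewrite -(ler_pM2r N0).
  have e1 : 2 * c * (h * mass f) <= 2 * c * flow (fun i => f i ^+ 2).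
    by rewrite ler_wpM2l// mulr_ge0.
  have e2 : c ^+ 2 * energy f <= c ^+ 2 * (l * mass f).
    by rewrite ler_wpM2l ?sqr_ge0.
  have e3 : c ^+ 2 * (l * mass f) = h * c * mass f by rewrite -lcE; ring.
  have := energy_ge0 f; lra.
have d0 : 0 <= d by have := mulr_ge0 h0 c0; lra.
(* For [d = 0] the quotient is 0 by the convention on inverses. *)
have [->|dn0] := eqVneq d 0; first by rewrite mulr0 invr0 mulr0 ltW.
have {}d0 : 0 < d by rewrite lt0r dn0.
rewrite ler_pdivrMr ?mulr_gt0//.
have -> : h ^+ 2 = l * (h * c) by rewrite mulrCA lcE expr2.
by rewrite ler_pM2l.
Qed.

(** The generalized eigenvalue problem [X f = l W f], with [W] the diagonal matrix of [mu]. *)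
Let pencil l f := forall j, \sum_i f i * X i j = l * (mu 0 j * f j).

(** Test the equation against the positive part [p]. Diagonal terms agree since [p * p = f * p]; off
    the diagonal [p >= f], [p >= 0] and [X i j <= 0] give the inequality. *)
Lemma energy_pos_part_le l f : pencil l f ->
  energy (fun i => Num.max (f i) 0) <= l * mass (fun i => Num.max (f i) 0).
Proof.
move=> fl; set p := fun i => Num.max (f i) 0.
have pp i : p i * p i = f i * p i.
  by rewrite /p; case: (leP (f i) 0); rewrite ?mulr0.
have -> : l * mass p = \sum_j \sum_i f i * X i j * p j.
  rewrite /mass mulr_sumr; apply: eq_bigr => j _; rewrite -mulr_suml fl.
  by rewrite expr2 pp !mulrA.
rewrite /energy exchange_big; apply: ler_sum => j _; apply: ler_sum => i _.
have [->|ij] := eqVneq i j; first by rewrite mulrAC pp mulrAC.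
rewrite -subr_le0 -!mulrA -mulrBl mulr_ge0_le0// ?subr_ge0 ?le_max ?lexx//.
by rewrite mulr_le0_ge0 ?X_offdiag ?le_max ?lexx ?orbT.
Qed.

Hypothesis mu_gt0 : forall i, 0 < mu 0 i.

Lemma mass_gt0 f i : f i != 0 -> 0 < mass f.
Proof.
move=> fi; rewrite /mass (bigD1 i)//= ltr_pwDl//.
  by rewrite mulr_gt0// exprn_even_gt0.
by apply: sumr_ge0 => j _; rewrite mulr_ge0 ?sqr_ge0 ?ltW.
Qed.

Lemma Vol_gt0 S : S != set0 -> 0 < Vol mu S.
Proof.
move=> /set0Pn[i iS]; rewrite /Vol (bigD1 i)//= ltr_pwDl//.
by apply: sumr_ge0 => j _; rewrite ltW.
Qed.

Lemma Vol_subset S T : S \subset T -> Vol mu S <= Vol mu T.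
Proof.
move=> ST; rewrite /Vol [leRHS](big_setID S) /= (setIidPr ST) lerDl.
by apply: sumr_ge0 => j _; rewrite ltW.
Qed.

Lemma Cut_ge0 S : 0 <= Cut X S.
Proof.
apply: sumr_ge0 => i iS; apply: sumr_ge0 => j jS.
by rewrite oppr_ge0 X_offdiag//; apply: contraNneq jS => <-.
Qed.

Lemma Bdy_ge0 S : 0 <= Bdy X S.
Proof. exact: sumr_ge0. Qed.

Lemma diag_le_Delta i : X i i <= Delta X mu * mu 0 i.
Proof.
rewrite -ler_pdivrMr//; rewrite /Delta.
have [_] := @max_overP R 'I_m xpredT (fun i => X i i / mu 0 i)
  (ex_intro _ i isT).
by apply; exists i.
Qed.

(** [cheeger_bound] for the positive part of [f]. Only sets inside its support are constrained,
    because without boundary the isoperimetric inequality is available only up to half the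
    volume. *)
Lemma cheeger_eigen h l f : 0 <= h -> 0 < l -> pencil l f ->
  (exists i, 0 < f i) ->
  (forall S, S != set0 -> S \subset [set i | 0 < f i] ->
    h * Vol mu S <= Cut X S + Bdy X S) ->
  h ^+ 2 / (2 * Delta X mu) <= l.
Proof.
move=> h0 l0 fl [i fi] hT.
apply: (@cheeger_bound h l _ (fun i => Num.max (f i) 0) h0 l0 hT).
- by move=> j; rewrite le_max lexx orbT.
- by move=> j; rewrite inE -leNgt => /max_r.
- by apply: (@mass_gt0 _ i); rewrite max_l ?gt_eqF ?ltW.
- exact: energy_pos_part_le.
- exact: diag_le_Delta.
Qed.

(** For [i] in [S], the entries of row [i] inside [S] sum to the row sum plus the weights leaving
    [S]. *)
Lemma energy_indicator S :
  energy (fun i => (i \in S)%:R) = Cut X S + Bdy X S.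
Proof.
rewrite /Cut /Bdy -big_split /energy /= [RHS]big_mkcond; apply: eq_bigr => i _.
case: (i \in S); last by rewrite big1 // => j _; rewrite !mul0r.
rewrite /row_sum [X in _ = X + _]big_mkcond -big_split; apply: eq_bigr => j _ /=.
by rewrite /weight; case: (j \in S); rewrite /= mul1r ?mulr1 ?mulr0 ?add0r ?addNr.
Qed.

Lemma mass_indicator S : mass (fun i => (i \in S)%:R) = Vol mu S.
Proof.
rewrite /mass /Vol [RHS]big_mkcond; apply: eq_bigr => i _.
by case: (i \in S); rewrite ?expr1n ?expr0n ?mulr1 ?mulr0.
Qed.

(** * Reduction of the normalized eigenvalue problem *)

Definition sqrt_weighted f : 'rV[R]_m := \row_i (Num.sqrt (mu 0 i) * f i).
Definition unweighted (v : 'rV[R]_m) i := v 0 i / Num.sqrt (mu 0 i).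

Let sqrt_mu_neq0 i : Num.sqrt (mu 0 i) != 0.
Proof. by rewrite gt_eqF ?sqrtr_gt0. Qed.

Lemma unweightedK v : sqrt_weighted (unweighted v) = v.
Proof. by apply/rowP => i; rewrite mxE mulrCA divff ?mulr1. Qed.

Lemma normalizedE i j : normalized X mu i j =
  (Num.sqrt (mu 0 i))^-1 * X i j * (Num.sqrt (mu 0 j))^-1.
Proof. by rewrite /normalized /inv_sqrt_diag mul_mx_diag mul_diag_mx !mxE. Qed.

Lemma normalized_sym : (normalized X mu)^T = normalized X mu.
Proof.
apply/matrixP => i j; rewrite mxE !normalizedE symX.
by rewrite mulrC mulrA mulrAC mulrC mulrA.
Qed.

Lemma mul_sqrt_weighted_normalized f j :
  (sqrt_weighted f *m normalized X mu) 0 j =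
  (\sum_i f i * X i j) / Num.sqrt (mu 0 j).
Proof.
rewrite mxE mulr_suml; apply: eq_bigr => i _; rewrite mxE normalizedE.
by rewrite !mulrA [_ * f i]mulrC mulfK.
Qed.

Lemma eigen_pencil f l :
  sqrt_weighted f *m normalized X mu = l *: sqrt_weighted f <-> pencil l f.
Proof.
have mu2 j : mu 0 j = Num.sqrt (mu 0 j) * Num.sqrt (mu 0 j).
  by rewrite -expr2 sqr_sqrtr ?ltW.
split=> [E j|fl].
  have /rowP/(_ j) := E; rewrite mul_sqrt_weighted_normalized !mxE.
  move=> /(congr1 (fun x => x * Num.sqrt (mu 0 j))); rewrite divfK// => ->.
  by rewrite {3}mu2; ring.
apply/rowP => j; rewrite mul_sqrt_weighted_normalized fl !mxE.
by rewrite {1}mu2; field.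
Qed.

Lemma dot_sqrt_weighted f g :
  dot (sqrt_weighted f) (sqrt_weighted g) = \sum_i mu 0 i * (f i * g i).
Proof.
rewrite dotE; apply: eq_bigr => i _; rewrite !mxE.
by rewrite mulrACA -expr2 sqr_sqrtr ?ltW.
Qed.

Lemma dot_mass f : dot (sqrt_weighted f) (sqrt_weighted f) = mass f.
Proof. by rewrite dot_sqrt_weighted. Qed.

Lemma dot_energy f :
  dot (sqrt_weighted f *m normalized X mu) (sqrt_weighted f) = energy f.
Proof.
rewrite dotE /energy exchange_big; apply: eq_bigr => j _.
by rewrite mul_sqrt_weighted_normalized mxE mulrA divfK// mulr_suml.
Qed.

Let eigenvalue_pencil a : eigenvalue (normalized X mu) a ->
  exists2 f, pencil a f & exists i, f i != 0.
Proof.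
move=> /eigenvalueP[v vE v0]; exists (unweighted v).
  by apply/eigen_pencil; rewrite unweightedK.
have [/existsP[]|/existsPn v_eq0] := boolP [exists i, v 0 i != 0].
  by move=> i vi; exists i; rewrite mulf_neq0 ?invr_neq0.
case/eqP: v0; apply/rowP => i; rewrite mxE; apply/eqP.
by have := v_eq0 i; rewrite negbK.
Qed.

Let sqrt_weighted_eq0 f : sqrt_weighted f = 0 -> forall i, f i = 0.
Proof.
move=> /rowP f0 i; have /eqP := f0 i.
by rewrite !mxE mulf_eq0 (negbTE (sqrt_mu_neq0 i)) => /eqP.
Qed.

Let neq0_coord f : sqrt_weighted f != 0 -> exists i, f i != 0.
Proof.
move=> f0; have [/existsP[i fi]|/existsPn f_eq0] := boolP [exists i, f i != 0].
  by exists i.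
case/eqP: f0; apply/rowP => i; rewrite !mxE.
by have := f_eq0 i; rewrite negbK => /eqP ->; rewrite mulr0.
Qed.

Let pencil_energy a f : pencil a f -> a * mass f = energy f.
Proof.
by move=> /eigen_pencil E; rewrite -dot_energy E dotZl dot_mass.
Qed.

Let set1_neq0 (i : 'I_m) : [set i] != set0.
Proof. by apply/set0Pn; exists i; rewrite inE. Qed.

Hypothesis X_conn : interior_connected X.

(** * The two cases *)

Section Dirichlet.
Hypothesis X_bdy : exists i, 0 < row_sum X i.

(** Zero energy makes [f] constant, and zero at an index of positive row sum. *)
Lemma energy_gt0 f i : f i != 0 -> 0 < energy f.
Proof.
move=> fi; rewrite lt0r energy_ge0 andbT; apply/eqP => /(energy_eq0 X_conn)[fc fb].
have [k bk] := X_bdy; have /eqP := fb k.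
by rewrite mulf_eq0 gt_eqF//= sqrf_eq0 (fc k i) (negbTE fi).
Qed.

Lemma normalized_positive_definite : positive_definite (normalized X mu).
Proof.
split=> [|v v0]; first exact: normalized_sym.
have := dot_energy (unweighted v^T); rewrite unweightedK /dot trmxK => ->.
have [i /energy_gt0] // : exists i, unweighted v^T i != 0.
by apply: neq0_coord; rewrite unweightedK -trmx0 (inj_eq trmx_inj).
Qed.

Lemma dirichlet_case (m_gt0 : (0 < m)%N) :
  exists lambda1 : R,
    [/\ is_smallest_eigenvalue (normalized X mu) lambda1,
        h_vol_Bdy X mu ^+ 2 / (2 * Delta X mu) <= lambda1
      & lambda1 <= h_vol_Bdy X mu].
Proof.
(* With [s = 0] the orthogonality constraint is void, so the minimum is over all vectors. *)
have [] := @symmetric_min_eigenvector R m (normalized X mu) 0 normalized_sym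
  (mul0mx _ _).
  exists (sqrt_weighted (fun=> 1)); last by rewrite /dot trmx0 mulmx0 mxE.
  by apply/eqP => /sqrt_weighted_eq0/(_ (Ordinal m_gt0))/eqP; rewrite oner_eq0.
move=> l [[v [v0 _] vE] lmin]; exists l.
have {}lmin f : l * mass f <= energy f.
  by rewrite -dot_mass -dot_energy lmin// /dot trmx0 mulmx0 mxE.
have [i fi] : exists i, unweighted v i != 0.
  by apply: neq0_coord; rewrite unweightedK.
have fl : pencil l (unweighted v) by apply/eigen_pencil; rewrite unweightedK.
set f := unweighted v in fi fl.
have l0 : 0 < l.
  by rewrite -(pmulr_lgt0 _ (mass_gt0 fi)) (pencil_energy fl) (energy_gt0 fi).
have [[S S0 hS] hmin] := @min_overP R {set 'I_m} (fun S => S != set0)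
  (fun S => (Cut X S + Bdy X S) / Vol mu S)
  (ex_intro _ [set Ordinal m_gt0] (set1_neq0 _)).
rewrite -/(h_vol_Bdy X mu) in hS hmin.
have h0 : 0 <= h_vol_Bdy X mu.
  by rewrite hS divr_ge0 ?addr_ge0 ?Cut_ge0 ?Bdy_ge0// ltW ?Vol_gt0.
have hT T : T != set0 -> h_vol_Bdy X mu * Vol mu T <= Cut X T + Bdy X T.
  move=> T0; rewrite -ler_pdivlMr ?Vol_gt0//; apply: hmin.
  by exists T.
split.
- split; first by apply/eigenvalueP; exists v.
  move=> a /eigenvalue_pencil[g ga [j gj]].
  by rewrite -(ler_pM2r (mass_gt0 gj)) (pencil_energy ga).
- have [fi0|fi0] := ltP 0 (f i).
    by apply: (cheeger_eigen h0 l0 fl) => [|T T0 _]; [exists i|exact: hT].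
  apply: (@cheeger_eigen _ _ (fun j => - f j) h0 l0) => [j||T T0 _].
  + by rewrite !mulrN -fl -sumrN; apply: eq_bigr => k _; rewrite mulNr.
  + by exists i; rewrite oppr_gt0 lt_neqAle fi.
  + exact: hT.
- rewrite hS ler_pdivlMr ?Vol_gt0// -mass_indicator -energy_indicator.
  exact: lmin.
Qed.

End Dirichlet.

(** * Boundaryless problem: bounds on the spectral gap *)

Section Boundaryless.
Hypothesis X_diag : forall i, 0 < X i i.
Hypothesis X_row_sum0 : forall i, row_sum X i = 0.

Let admissible S := (S != set0) && (Vol mu S <= Vtot mu / 2).

Let Bdy0 S : Bdy X S = 0.
Proof. by rewrite /Bdy big1. Qed.

Let VolC S : Vol mu S + Vol mu (~: S) = Vtot mu.
Proof.
rewrite /Vtot /Vol [RHS](big_setID S) /= setTI; congr (_ + _).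
by apply: eq_bigl => i; rewrite !inE andbT.
Qed.

(** A singleton or its complement has at most half the volume. The complement is nonempty, since a
    single vertex would have row sum [X i0 i0 > 0]. *)
Lemma admissible_exists (m_gt0 : (0 < m)%N) : exists S, admissible S.
Proof.
pose i0 := Ordinal m_gt0; pose S := [set i0].
have SC0 : ~: S != set0.
  apply/negP => /eqP SC; have := X_diag i0; rewrite -[ltRHS]addr0.
  have := X_row_sum0 i0; rewrite /row_sum (bigD1 i0)//= big1 => [->|j ji0].
    by rewrite ltxx.
  by have := in_set0 j; rewrite -SC !inE ji0.
have [SV|/ltW SV] := leP (Vol mu S) (Vtot mu / 2).
  by exists S; rewrite /admissible SV set1_neq0.
exists (~: S); rewrite /admissible SC0 /=; have := VolC S; lra.
Qed.

Lemma energy_shift f c : energy (fun i => f i - c) = energy f.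
Proof.
apply: (@mulfI R 2); first by rewrite pnatr_eq0.
rewrite !energyE; congr (_ + _ * _).
  by do 2 (apply: eq_bigr => ? _); congr (_ * _ ^+ 2); ring.
by apply: eq_bigr => i _; rewrite X_row_sum0 !mul0r.
Qed.

Lemma exists_gt0 f i : \sum_j mu 0 j * f j = 0 -> f i != 0 -> exists k, 0 < f k.
Proof.
move=> f0 fi; have [/existsP[k]|/existsPn fle] := boolP [exists k, 0 < f k].
  by exists k.
have fle0 k : f k <= 0 by rewrite leNgt fle.
have /psumr_eq0P/(_ i) : \sum_j - (mu 0 j * f j) = 0 by rewrite sumrN f0 oppr0.
move=> /(_ _ isT)/eqP; rewrite oppr_eq0 mulf_eq0 (negbTE fi) gt_eqF// => H.
by suff : false by []; apply: H => j _; rewrite oppr_ge0 pmulr_rle0.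
Qed.

(** The mass is [Vol mu S * (1 - Vol mu S / Vtot mu)], whose second factor is at least 1/2 by
    admissibility; the energy ignores constant shifts. *)
Lemma centered_indicator S : admissible S ->
  let g i := (i \in S)%:R - Vol mu S / Vtot mu in
  [/\ \sum_i mu 0 i * g i = 0, Vol mu S / 2 <= mass g & energy g = Cut X S].
Proof.
move=> /andP[S0 SV] g.
have VS := Vol_gt0 S0; have V0 : 0 < Vtot mu by lra.
have sumS : \sum_i mu 0 i * (i \in S)%:R = Vol mu S.
  rewrite /Vol [RHS]big_mkcond; apply: eq_bigr => i _.
  by case: (i \in S); rewrite ?mulr1 ?mulr0.
have sumV : \sum_i mu 0 i = Vtot mu.
  by rewrite /Vtot /Vol; apply: eq_bigl => i; rewrite inE.
have gsum : \sum_i mu 0 i * g i = 0.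
  under eq_bigr => i _ do rewrite mulrBr.
  by rewrite sumrB sumS -mulr_suml sumV mulrCA divff ?mulr1 ?subrr ?gt_eqF.
split=> //.
  have -> : mass g = Vol mu S - Vol mu S / Vtot mu * Vol mu S.
    (* Replace one factor of [g ^+ 2] by its definition: the constant part multiplies the vanishing
       weighted sum of [g]. *)
    have -> : mass g = \sum_i (mu 0 i * (i \in S)%:R -
        Vol mu S / Vtot mu * (mu 0 i * (i \in S)%:R)) -
        Vol mu S / Vtot mu * \sum_i mu 0 i * g i.
      rewrite mulr_sumr -sumrB; apply: eq_bigr => i _; rewrite /g.
      by case: (i \in S) => /=; ring.
    by rewrite gsum mulr0 subr0 sumrB -mulr_sumr sumS.
  have : Vol mu S / Vtot mu <= 1 / 2 by rewrite ler_pdivrMr//; lra.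
  move=> /(ler_wpM2r (ltW VS)); lra.
by rewrite energy_shift energy_indicator Bdy0 addr0.
Qed.

Lemma boundaryless_case (m_gt0 : (0 < m)%N) :
  exists lambda1 : R,
    [/\ is_smallest_nonzero_eigenvalue (normalized X mu) lambda1,
        h_vol X mu ^+ 2 / (2 * Delta X mu) <= lambda1
      & lambda1 <= 2 * h_vol X mu].
Proof.
have [[S Sadm hS] hmin] := @min_overP R {set 'I_m} admissible
  (fun S => Cut X S / Vol mu S) (admissible_exists m_gt0).
rewrite -/(h_vol X mu) in hS hmin.
have S0 : S != set0 by case/andP: Sadm.
have h0 : 0 <= h_vol X mu.
  by rewrite hS divr_ge0 ?Cut_ge0// ltW ?Vol_gt0.
pose g i := (i \in S)%:R - Vol mu S / Vtot mu.
have [gsum gmass genergy] : [/\ \sum_i mu 0 i * g i = 0,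
    Vol mu S / 2 <= mass g & energy g = Cut X S] by exact: centered_indicator.
have mg0 : 0 < mass g by have := Vol_gt0 S0; lra.
have dot_one f : dot (sqrt_weighted f) (sqrt_weighted (fun=> 1)) =
    \sum_i mu 0 i * f i.
  by rewrite dot_sqrt_weighted; apply: eq_bigr => i _; rewrite mulr1.
(* Constants solve the pencil for eigenvalue 0, as all row sums vanish; orthogonality to this kernel
   vector is the condition of zero weighted sum. *)
have one_ker : sqrt_weighted (fun=> 1) *m normalized X mu = 0.
  rewrite -[RHS](scale0r (sqrt_weighted (fun=> 1))); apply/eigen_pencil => j.
  by rewrite mul0r -[RHS](X_row_sum0 j); apply: eq_bigr => i _; rewrite mul1r symX.
have [] := symmetric_min_eigenvector normalized_sym one_ker.
  exists (sqrt_weighted g); last by rewrite dot_one.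
  by rewrite -dot_eq0 dot_mass gt_eqF.
move=> l [[v [v0 vs] vE] lmin]; exists l.
have {}lmin f : \sum_i mu 0 i * f i = 0 -> l * mass f <= energy f.
  by rewrite -dot_one -dot_mass -dot_energy => /lmin.
have [i fi] : exists i, unweighted v i != 0.
  by apply: neq0_coord; rewrite unweightedK.
have fl : pencil l (unweighted v) by apply/eigen_pencil; rewrite unweightedK.
have fs : \sum_i mu 0 i * unweighted v i = 0 by rewrite -dot_one unweightedK.
set f := unweighted v in fi fl fs.
have l_ge0 : 0 <= l.
  by rewrite -(pmulr_lge0 _ (mass_gt0 fi)) (pencil_energy fl) energy_ge0.
(* Otherwise [f] is constant by connectedness, and its zero weighted sum forces [f = 0]. *)
have l_neq0 : l != 0.
  apply: contra_neq fi => l0.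
  have E0 : energy f = 0 by rewrite -(pencil_energy fl) l0 mul0r.
  have [fc _] := energy_eq0 X_conn E0.
  have := fs; under eq_bigr => j _ do rewrite (fc j i).
  rewrite -mulr_suml => /eqP; rewrite mulf_eq0 gt_eqF ?orFb => [/eqP //|].
  by rewrite (bigD1 i)//= ltr_pwDl// sumr_ge0// => j _; rewrite ltW.
have l0 : 0 < l by rewrite lt0r l_neq0.
have hT T : admissible T -> h_vol X mu * Vol mu T <= Cut X T + Bdy X T.
  move=> Tadm; rewrite Bdy0 addr0 -ler_pdivlMr ?Vol_gt0//; last by case/andP: Tadm.
  by apply: hmin; exists T.
split.
- split; first by split=> //; apply/eigenvalueP; exists v.
  move=> a [/eigenvalue_pencil[g' ga [j gj]] a0].
  rewrite -(ler_pM2r (mass_gt0 gj)) (pencil_energy ga) lmin//.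
  (* An eigenvector for [a != 0] is orthogonal to the kernel vector, by symmetry, so it competes in
     the minimum. *)
  apply: (mulfI a0); rewrite mulr0 -dot_one -dotZl -(eigen_pencil _ _).2//.
  by rewrite dot_sym ?normalized_sym// one_ker /dot trmx0 mulmx0 mxE.
(* If the positive set of [f] exceeds half the volume, its complement does not, and it contains the
   positive set of [- f]. *)
- have [Pf|Pf] := leP (Vol mu [set i | 0 < f i]) (Vtot mu / 2).
    apply: (cheeger_eigen h0 l0 fl) => [|T T0 TP]; first exact: exists_gt0 fs fi.
    by apply: hT; rewrite /admissible T0 (le_trans (Vol_subset TP)).
  apply: (@cheeger_eigen _ _ (fun j => - f j) h0 l0) => [j||T T0 TP].
  + by rewrite !mulrN -fl -sumrN; apply: eq_bigr => k _; rewrite mulNr.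
  + apply: (@exists_gt0 _ i); last by rewrite oppr_eq0.
    by under eq_bigr => k _ do rewrite mulrN; rewrite sumrN fs oppr0.
  + apply: hT; rewrite /admissible T0.
    rewrite (le_trans (Vol_subset (T := ~: [set i | 0 < f i]) _))//.
      rewrite (subset_trans TP)//; apply/subsetP => k; rewrite !inE oppr_gt0.
      by rewrite -leNgt => /ltW.
    have := VolC [set i | 0 < f i]; lra.
(* The factor 2 comes from [mass g >= Vol mu S / 2] for the centered indicator of a minimizing
   [S]. *)
- rewrite hS mulrA ler_pdivlMr ?Vol_gt0//.
  have := lmin _ gsum; have := ler_wpM2l l_ge0 gmass; rewrite genergy; lra.
Qed.

End Boundaryless.

End CheegerInequality.

Theorem theorem2p1 (R : realType) (m : nat) (X : 'M[R]_m) (mu : 'rV[R]_m)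
  (m_gt0 : (0 < m)%N)
  (X_sym : X^T = X)
  (X_diag : forall i, 0 < X i i)
  (X_offdiag : forall i j, i != j -> X i j <= 0)
  (X_row_sum : forall i, 0 <= row_sum X i)
  (mu_gt0 : forall i, 0 < mu 0 i)
  (X_conn : interior_connected X) :
  ((forall i, row_sum X i = 0) ->
     exists lambda1 : R,
       [/\ is_smallest_nonzero_eigenvalue (normalized X mu) lambda1,
           h_vol X mu ^+ 2 / (2 * Delta X mu) <= lambda1
         & lambda1 <= 2 * h_vol X mu])
  /\
  ((exists i, 0 < row_sum X i) ->
     positive_definite (normalized X mu) /\
     exists lambda1 : R,
       [/\ is_smallest_eigenvalue (normalized X mu) lambda1,
           h_vol_Bdy X mu ^+ 2 / (2 * Delta X mu) <= lambda1
         & lambda1 <= h_vol_Bdy X mu]).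
Proof.
split=> [X_row_sum0|X_bdy]; first exact: boundaryless_case.
by split; [exact: normalized_positive_definite|exact: dirichlet_case].
Qed.
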